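(* Let $E$ be a Cantor set on $\mathbb{R}^d$ that is Newhouse projectively thick. Then $E$ is not generically universal.
   Context: $m$ denotes Lebesgue measure. A Cantor set in $\mathbb{R}^d$ is a nonempty, totally disconnected, perfect and compact subset of $\mathbb{R}^d$. An affine copy of $E\subset\mathbb{R}^d$ is a set $t+T(E)$ with $t\in\mathbb{R}^d$ and $T$ an invertible linear transformation on $\mathbb{R}^d$. A set $E\subset\mathbb{R}^d$ is generically universal if every dense $G_\delta$ set $G\subset\mathbb{R}^d$ with $m(\mathbb{R}^d\setminus G)=0$ contains an affine copy of $E$. Newhouse thickness of Cantor sets. Let $K\subset\mathbb{R}$ be a Cantor set. A gap of $K$ is a connected component of $\mathbb{R}\setminus K$; a bounded gap is a bounded connected component of $\mathbb{R}\setminus K$. $|I|$ denotes the length of an interval $I$ (unbounded gaps have infinite length). Let $U=(u',u)$ be a bounded gap of $K$. The bridge $C$ of $K$ at $u$ is the maximal interval on the right hand side of $u$ such that $u$ is a boundary point of $C$ and $C$ contains no point of a gap $U'$ with $|U'|\ge |U|$. The bridge at $u'$ is defined analogously, as the maximal interval on the left hand side of $u'$ with the same property. For a boundary point $u$ of a bounded gap $U$ with bridge $C$ at $u$, $\tau(K,u)=|C|/|U|$, and $\tau(K)=\inf_{u\in\mathcal{U}}\tau(K,u)$, where $\mathcal{U}$ is the set of all boundary points of bounded gaps of $K$. Newhouse thickness of compact sets. For a compact set $K\subset\mathbb{R}$, a point $x\in K$ is a condensation point of $K$ if every open neighborhood of $x$ contains uncountably many points of $K$. The perfect part $P_K$ of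 $K$ is the set of all condensation points of $K$. Define $\tau(K)=0$ if $P_K=\emptyset$; $\tau(K)=\infty$ if $P_K$ contains an interval (of positive length); and $\tau(K)=\tau(P_K)$ otherwise (in which case $P_K$ is a Cantor set). A Cantor set $E\subset\mathbb{R}^d$ is Newhouse projectively thick if for all invertible linear transformations $T$ on $\mathbb{R}^d$, the orthogonal projection of $T(E)$ onto the $x_1$-axis (regarded as a compact subset of $\mathbb{R}$) has positive Newhouse thickness (the value $\infty$ being allowed). *)

(* Defs.v *)
From HB Require Import structures.
From mathcomp Require Import all_boot all_order all_algebra.
From mathcomp Require Import all_classical all_reals all_analysis borel_hierarchy.

Set Implicit Arguments.
Unset Strict Implicit.
Unset Printing Implicit Defensive.

Import Order.TTheory GRing.Theory Num.Theory.
Import numFieldNormedType.Exports.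

Local Open Scope classical_set_scope.
Local Open Scope ring_scope.

Definition cantor_set (T : topologicalType) (E : set T) : Prop :=
  [/\ E !=set0, totally_disconnected E, perfect_set E & compact E].

Definition frontier (T : topologicalType) (A : set T) : set T :=
  closure A `\` interior A.

(* Lebesgue measure on R^d. The library only provides it on R, so we use the
   outer measure given by countable covers by closed boxes. It agrees with
   Lebesgue measure on Lebesgue measurable sets; below it is only applied to
   the F_sigma complement of a G_delta set. *)
Section LebesgueRd.
Variables (R : realType) (d : nat).

Definition box (a b : 'cV[R]_d) : set 'cV[R]_d :=
  [set x | forall i, a i 0 <= x i 0 <= b i 0].

Definition box_volume (a b : 'cV[R]_d) : R := \prod_i (b i 0 - a i 0).

Definition lebesgue_outer (A : set 'cV[R]_d) : \bar R :=
  ereal_inf [set s | exists a b : nat -> 'cV[R]_d,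
    [/\ forall k i, a k i 0 <= b k i 0,
        A `<=` \bigcup_k box (a k) (b k) &
        s = (\sum_(0 <= k <oo) (box_volume (a k) (b k))%:E)%E]].

End LebesgueRd.

Section Universality.
Variables (R : realType) (d : nat).

Definition affine_copy (E F : set 'cV[R]_d) : Prop :=
  exists (t : 'cV[R]_d) (T : 'M[R]_d),
    T \in unitmx /\ F = [set t + T *m x | x in E].

Definition generically_universal (E : set 'cV[R]_d) : Prop :=
  forall G : set 'cV[R]_d, Gdelta G -> dense G -> lebesgue_outer (~` G) = 0%E ->
    exists2 F, affine_copy E F & F `<=` G.

End Universality.

Section Thickness.
Variable R : realType.
Implicit Types (K I C : set R).

Definition gap K I : Prop :=
  exists2 x, (~` K) x & I = connected_component (~` K) x.

(* On intervals, [lebesgue_measure] is the length, [+oo] if unbounded. *)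
Local Notation len := (@lebesgue_measure R).

(* [u] is an endpoint of the bounded gap [U], and [H] is the closed half-line
   with endpoint [u] that lies on the other side of [u] from [U]. *)
Definition pre_bridge K (U H : set R) (u : R) C : Prop :=
  [/\ is_interval C, C `<=` H, frontier C u &
      forall U', gap K U' -> (len U <= len U')%E -> C `&` U' = set0].

Definition bridge K (U H : set R) (u : R) C : Prop :=
  pre_bridge K U H u C /\
  forall D, pre_bridge K U H u D -> C `<=` D -> D = C.

(* For a Cantor set [K]: each endpoint of a bounded gap has exactly one
   bridge. *)
Definition cantor_thickness K : \bar R :=
  ereal_inf [set s | exists (u' u : R) C,
    [/\ gap K `]u', u[,
        bridge K `]u', u[ `[u, +oo[ u C \/ bridge K `]u', u[ `]-oo, u'] u' C &
        s = (len C / len `]u', u[)%E]].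

Definition condensation_point K (x : R) : Prop :=
  K x /\ forall V : set R, open V -> V x -> ~ countable (V `&` K).

Definition perfect_part K : set R := [set x | condensation_point K x].

Definition newhouse_thickness K : \bar R :=
  let P := perfect_part K in
  if `[< P = set0 >] then 0%E
  else if `[< exists a b : R, a < b /\ `[a, b] `<=` P >] then +oo%E
  else cantor_thickness P.

End Thickness.

Section ProjectivelyThick.
Variables (R : realType) (d : nat).

Definition proj_x1 (x : 'cV[R]_d.+1) : R := x ord0 ord0.

Definition newhouse_projectively_thick (E : set 'cV[R]_d.+1) : Prop :=
  forall T : 'M[R]_d.+1, T \in unitmx ->
    (0 < newhouse_thickness (proj_x1 @` [set T *m x | x in E]))%E.

End ProjectivelyThick.

(* Main.v *)
Require Import Defs.
From mathcomp Require Import all_boot all_order all_algebra.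
From mathcomp Require Import all_classical all_reals all_analysis borel_hierarchy.
From mathcomp Require Import lra ring.
Import Order.TTheory GRing.Theory Num.Theory.
Import numFieldNormedType.Exports.

Set Implicit Arguments.
Unset Strict Implicit.
Unset Printing Implicit Defensive.

Local Open Scope classical_set_scope.
Local Open Scope ring_scope.

(** Write K for the projection of an affine copy of E to the first axis.  It is
enough to find a meagre null F_sigma set N of reals that meets every translate
of every such K: the points whose first coordinate avoids N then form a dense
G_delta of full measure that contains no affine copy of E.

The reason such an N exists is Newhouse's gap lemma ([gap_lemma]): two compact
sets whose thicknesses have product at least 1, and whose convex hulls overlap
without one set lying in a gap of the other, must intersect.  Hence a set of
positive thickness, however small, cannot avoid a suitably placed Cantor set of
large enough thickness.  Middle Cantor sets have measure zero but reach every
thickness ([thick_middle_cantor]), so N is taken to be the union over naturals n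
and rationals q of a copy, dilated by n+1 and starting at q, of a middle Cantor
set of thickness n+1.  Given t and K of thickness at least eps > 0, taking n
large makes both the product of the thicknesses and the diameter of the copy
large enough, and the rational q is used to place the left end of the copy
inside the hull of t + K; this is [dilated_cantor_hit].

Only a consequence of Newhouse's definition enters the gap lemma, isolated as
[thick]: a point outside the set which is close to a gap, relative to the length
of this gap, lies in a strictly shorter gap.  That positive Newhouse thickness
gives it for the perfect part of K is [newhouse_thick]; if the perfect part
contains an interval, then its translate by t contains a rational, and all
rationals are in N. *)

(** * Gaps, thickness and the gap lemma *)

Section GapLemma.
Variable R : realType.
Implicit Types (A B : set R) (a b u v x y alpha beta delta : R).

Definition is_gap A a b : Prop :=
  [/\ a < b, A a, A b & forall x, a < x < b -> ~ A x].

(** For a Cantor set, this follows from Newhouse thickness at least [alpha]: the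
point [y] lies in the bridge at [b] or at [a], and the gaps inside a bridge are
shorter than the gap it belongs to.  No maximal interval is involved, so that
the property is easily checked on self-similar sets. *)
Definition thick A alpha : Prop := forall a b y, is_gap A a b -> ~ A y ->
  b < y < b + alpha * (b - a) \/ a - alpha * (b - a) < y < a ->
  exists c d, [/\ is_gap A c d, c < y < d & d - c < b - a].

Lemma gap_around A a b y : closed A -> A a -> A b -> a < y < b -> ~ A y ->
  exists c d, [/\ is_gap A c d, c < y < d, a <= c & d <= b].
Proof.
move=> clA Aa Ab /andP[ay yb] nAy.
(* The gap around [y] goes from the supremum of [L] to the infimum of the points
   above [y], written as the opposite of the supremum of [H]. *)
pose L := A `&` [set x | x <= y]; pose H := -%R @` (A `&` [set x | y <= x]).
have La : L a by split => //=; exact: ltW.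
have ubL : has_ubound L by exists y => x [].
have Hb : H (- b) by exists b => //; split => //=; exact: ltW.
have ubH : has_ubound H by exists (- y) => _ [x [_ /= yx] <-]; rewrite lerN2.
have clL : closed L by apply: closedI => //; exact: closed_le.
have clH : closed (A `&` [set x | y <= x]) by apply: closedI => //; exact: closed_ge.
have [Ac cy] : L (sup L) by apply: clL; apply: closure_sup => //; exists a.
have [Ad yd] : (A `&` [set x | y <= x]) (- sup H).
  have : closed H.
    rewrite /H (_ : -%R @` _ = -%R @^-1` (A `&` [set x | y <= x])).
      by apply: preimage_closed => // z _; exact: opp_continuous.
    apply/seteqP; split => x /=; first by case=> z ? <-; rewrite opprK.
    by move=> ?; exists (- x) => //; rewrite opprK.
  move=> clH'.
  have : H (sup H) by apply: clH'; apply: closure_sup => //; exists (- b).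
  by case=> z hz <-; rewrite opprK.
rewrite /= in cy yd.
have cy' : sup L < y by rewrite lt_neqAle cy andbT; apply/eqP => e; rewrite e in Ac.
have yd' : y < - sup H by rewrite lt_neqAle yd andbT; apply/eqP => e; rewrite -e in Ad.
exists (sup L), (- sup H); split.
- split=> //; first exact: lt_trans yd'.
  move=> x /andP[cx xd] Ax; have [xy|yx] := leP x y.
    by have := ub_le_sup ubL (conj Ax xy : L x); rewrite leNgt cx.
  have Hx : H (- x) by exists x => //; split => //=; exact: ltW.
  by have := ub_le_sup ubH Hx; rewrite lerNl leNgt xd.
- by rewrite cy'.
- exact: ub_le_sup.
- by rewrite lerNl; exact: ub_le_sup.
Qed.

Lemma gap_uniq A a b c d : is_gap A a b -> is_gap A c d -> a <= c < b ->
  a = c /\ b = d.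
Proof.
move=> [ab Aa Ab gab] [cd Ac Ad gcd] /andP[ac cb].
have eac : a = c.
  by apply/eqP; rewrite eq_le ac leNgt; apply/negP => ca; apply: (gab c) => //; rewrite ca.
split=> //; subst c; apply/eqP; rewrite eq_le !leNgt.
apply/andP; split; apply/negP => h.
  by apply: (gab d) => //; rewrite cd.
by apply: (gcd b) => //; rewrite ab.
Qed.

(** Only finitely many gaps of a bounded set have length at least [delta], which
makes their strict order by length well founded: the rank of a length [l] is the
number of cells of a subdivision of mesh [delta] that contain the left end of a
gap of length between [delta] and [l].  Such a cell contains only one left end,
because the gap starting there covers the rest of the cell. *)
Lemma gap_rank A m M delta : 0 < delta -> A `<=` `[m, M] ->
  exists rk : R -> nat, forall a b c d, is_gap A a b -> is_gap A c d ->
    delta <= d - c < b - a -> (rk (d - c)%R < rk (b - a)%R)%N.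
Proof.
move=> d0 AM.
pose idx (a : R) := Num.truncn ((a - m) / delta).
pose n := (idx M).+1.
pose cnt l : {set 'I_n} := finset (fun i : 'I_n =>
  `[< exists a b, [/\ is_gap A a b, delta <= b - a <= l & i = idx a :> nat] >]).
have idxE x : m <= x -> (idx x)%:R * delta <= x - m < (idx x).+1%:R * delta.
  move=> mx; rewrite -ler_pdivlMr// -ltr_pdivrMr//.
  by apply: truncn_itv; rewrite divr_ge0 ?subr_ge0// ltW.
have AmM x : A x -> m <= x <= M by move/AM; rewrite /= in_itv.
exists (fun l => #|cnt l|) => a b c d gab gcd /andP[ddc dcba].
apply: proper_card; apply/properP; split.
  apply/fintype.subsetP => i; rewrite !finset.inE => /asboolP[u [v [guv /andP[h1 h2] iE]]].
  by apply/asboolP; exists u, v; split => //; rewrite h1 (le_trans h2)// ltW.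
have [ab Aa Ab _] := gab.
have lan : (idx a < n)%N.
  rewrite ltnS; apply: le_truncn; rewrite ler_pM2r ?invr_gt0// lerB//.
  by case/andP: (AmM _ Aa).
exists (Ordinal lan).
  rewrite finset.inE; apply/asboolP; exists a, b; split => //.
  by rewrite lexx (le_trans ddc)// ltW.
rewrite finset.inE; apply/negP => /asboolP[u [v [guv /andP[h1 h2] /= iE]]].
have [uv Au Av _] := guv.
have /andP[ma _] := AmM _ Aa; have /andP[mu _] := AmM _ Au.
have /andP[ea1 ea2] := idxE _ ma; have /andP[eu1 eu2] := idxE _ mu.
rewrite -iE in eu1 eu2.
have e3 : (idx a).+1%:R * delta = (idx a)%:R * delta + delta by rewrite -natr1 mulrDl mul1r.
rewrite e3 in ea2 eu2.
have [au|ua] := leP a u.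
  have [? ?] : a = u /\ b = v by apply: gap_uniq gab guv _; rewrite au /=; lra.
  by subst; lra.
have [? ?] : u = a /\ v = b by apply: gap_uniq guv gab _; lra.
by subst; lra.
Qed.

(** The descent behind the gap lemma.  Let the gap U of A and the gap V of B be
linked, with u' < v' < u < v.  Either V is short enough relative to U for the
thickness of A to put [v] in a gap of A shorter than U, or U is short enough
relative to V for the thickness of B to put [u'] in a gap of B shorter than V.
Either way the new gap is linked with the remaining old one, with the sets in
the opposite order; hence the induction quantifies over both sets.  Linked gaps
have length at least [delta], since each contains an endpoint of the other, so
the ranks [rA] and [rB] of lengths apply and their sum decreases. *)
Lemma no_linked_gaps delta : 0 < delta -> forall n A B (rA rB : R -> nat) alpha beta,
  closed A -> closed B -> thick A alpha -> thick B beta ->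
  0 < beta -> 1 <= alpha * beta -> 0 < alpha ->
  (forall x y, A x -> B y -> delta <= `|x - y|) ->
  (forall a b c d, is_gap A a b -> is_gap A c d ->
    delta <= d - c < b - a -> (rA (d - c)%R < rA (b - a)%R)%N) ->
  (forall a b c d, is_gap B a b -> is_gap B c d ->
    delta <= d - c < b - a -> (rB (d - c)%R < rB (b - a)%R)%N) ->
  forall u' u v' v, is_gap A u' u -> is_gap B v' v -> u' < v' -> v' < u -> u < v ->
    (rA (u - u')%R + rB (v - v')%R < n)%N -> False.
Proof.
move=> delta0; elim=> // n IH A B rA rB alpha beta clA clB tA tB b0 ab1 a0 dAB hA hB.
move=> u' u v' v gU gV u'v' v'u uv; rewrite ltnS => ltn.
have [_ Au' Au gU'] := gU; have [_ Bv' Bv gV'] := gV.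
have nA x : B x -> ~ A x.
  by move=> Bx Ax; have := dAB _ _ Ax Bx; rewrite subrr normr0 leNgt delta0.
have dBA x y : B x -> A y -> delta <= `|x - y| by move=> ? ?; rewrite distrC; exact: dAB.
have ba1 : 1 <= beta * alpha by rewrite mulrC.
have far x y : x < y -> (A x /\ B y) \/ (B x /\ A y) -> delta <= y - x.
  move=> xy h; have -> : y - x = `|y - x| by rewrite gtr0_norm ?subr_gt0.
  by case: h => -[? ?]; [exact: dBA|exact: dAB].
have [h|h] := leP (v - v') (alpha * (u - u')).
  have [||c [d [gcd /andP[cv vd] dc]]] := tA u' u v gU; [exact: nA|left; lra|].
  have [_ Ac Ad gcd'] := gcd.
  have uc : u <= c.
    by rewrite leNgt; apply/negP => cu; apply: (gcd' u) => //; lra.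
  have d1 := far _ _ cv (or_introl (conj Ac Bv)).
  apply: (IH B A rB rA beta alpha clB clA tB tA a0 ba1 b0 dBA hB hA v' v c d) => //; first by lra.
  apply: leq_trans ltn; rewrite addnC ltn_add2r; apply: hA => //; rewrite dc andbT; lra.
have h' : u - u' < beta * (v - v').
  have h1 : beta * (alpha * (u - u')) < beta * (v - v') by rewrite ltr_pM2l.
  rewrite mulrA in h1; apply: le_lt_trans h1.
  have : 0 <= (beta * alpha - 1) * (u - u') by apply: mulr_ge0; lra.
  lra.
have [||c [d [gcd /andP[cv vd] dc]]] := tB v' v u' gV; [by move=> Bu'; exact: nA Bu' Au'|right; lra|].
have [_ Bc Bd gcd'] := gcd.
have dv : d <= v'.
  by rewrite leNgt; apply/negP => cu; apply: (gcd' v') => //; lra.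
have d1 := far _ _ vd (or_introl (conj Au' Bd)).
apply: (IH B A rB rA beta alpha clB clA tB tA a0 ba1 b0 dBA hB hA c d u' u) => //; first by lra.
apply: leq_trans ltn; rewrite addnC ltn_add2l; apply: hB => //; rewrite dc andbT; lra.
Qed.

(** The set of differences is compact, so it stays away from 0. *)
Lemma compact_disjoint_far A B : compact A -> compact B -> A `&` B = set0 ->
  exists2 delta, 0 < delta & forall x y, A x -> B y -> delta <= `|x - y|.
Proof.
move=> cA cB AB0.
pose D := (fun p : R * R => p.1 - p.2) @` (A `*` B).
have cD : compact D.
  apply: continuous_compact; last exact: compact_setX.
  apply: continuous_subspaceT => p; apply: cvgB; [exact: cvg_fst|exact: cvg_snd].
have nD0 : ~ D 0.
  case=> -[x y] [/= Ax By] /eqP; rewrite subr_eq0 => /eqP xy; subst y.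
  by have : (A `&` B) x by []; rewrite AB0.
have oD : open (~` D) by apply: closed_openC; apply: compact_closed => //; exact: norm_hausdorff.
have /nbhs_ballP[e /= e0 he] := open_nbhs_nbhs (conj oD nD0 : open_nbhs 0 (~` D)).
exists e => // x y Ax By; rewrite leNgt; apply/negP => h.
apply: (he (x - y)); last by exists (x, y).
by rewrite /ball /= sub0r normrN.
Qed.

Lemma compact_sub_itv A : compact A -> exists m M, A `<=` `[m, M].
Proof.
move=> /compact_bounded [r [_ hr]].
exists (- (r + 1)), (r + 1) => x Ax.
have := hr (r + 1) _ x Ax; rewrite ltrDl ltr01 => /(_ erefl).
by rewrite /= in_itv /= ler_norml.
Qed.

(** The points a < a' < b < b' of alternating origin exclude that one of the sets
lies in a gap of the other.  If the sets were disjoint, then [a'] would be in a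
gap of A, the right end of this gap would be in a gap of B, and these two gaps
would be linked. *)
Lemma gap_lemma A B alpha beta a b a' b' : compact A -> compact B ->
  thick A alpha -> thick B beta -> 0 < alpha -> 0 < beta -> 1 <= alpha * beta ->
  A a -> B a' -> A b -> B b' -> a < a' -> a' < b -> b < b' -> A `&` B !=set0.
Proof.
move=> cA cB tA tB a0 b0 ab1 Aa Ba' Ab Bb' aa' a'b bb'; apply: contrapT => /nonemptyPn AB0.
have clA : closed A by apply: compact_closed => //; exact: norm_hausdorff.
have clB : closed B by apply: compact_closed => //; exact: norm_hausdorff.
have [delta delta0 far] := compact_disjoint_far cA cB AB0.
have [mA [MA sA]] := compact_sub_itv cA; have [mB [MB sB]] := compact_sub_itv cB.
have [rA hA] := gap_rank delta0 sA; have [rB hB] := gap_rank delta0 sB.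
have nAB x : A x -> ~ B x by move=> Ax Bx; have : (A `&` B) x by []; rewrite AB0.
have [||u' [u [gU /andP[u'a' a'u] au' ub]]] := gap_around clA Aa Ab (y := a');
  [lra|by move=> /nAB|].
have [_ Au' Au gU'] := gU.
have [||v' [v [gV /andP[v'u uv] av' vb]]] := gap_around clB Ba' Bb' (y := u);
  [lra|exact: nAB|].
apply: (no_linked_gaps delta0 clA clB tA tB b0 ab1 a0 far hA hB gU gV _ v'u uv (ltnSn _)).
exact: lt_le_trans av'.
Qed.

End GapLemma.

(** * Affine images *)

Section AffineGaps.
Variable R : realType.
Implicit Types (A : set R) (a b c r : R).

Lemma is_gap_affine A c r a b : 0 < r ->
  is_gap ((fun x => c + r * x) @` A) (c + r * a) (c + r * b) <-> is_gap A a b.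
Proof.
move=> r0; have im x : ((fun x => c + r * x) @` A) (c + r * x) <-> A x.
  split=> [[y Ay /addrI /(mulfI (lt0r_neq0 r0)) <-]//|Ax]; by exists x.
have lt x y : (c + r * x < c + r * y) = (x < y) by rewrite ltrD2l ltr_pM2l.
split=> -[]; rewrite ?lt => ab /im Aa /im Ab gab; split; rewrite ?lt//.
  by move=> x /andP[ax xb] Ax; apply: (gab (c + r * x)); [rewrite !lt ax|exact/im].
by move=> _ /[swap] -[x Ax <-]; rewrite !lt => /gab.
Qed.

Lemma thick_affine A c r alpha : 0 < r -> thick A alpha ->
  thick ((fun x => c + r * x) @` A) alpha.
Proof.
move=> r0 tA a b y gab nAy hy.
have shape z : z = c + r * ((z - c) / r) by rewrite mulrC divfK ?lt0r_neq0// addrC subrK.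
move: gab hy nAy; rewrite (shape a) (shape b) (shape y).
move: ((a - c) / r) ((b - c) / r) ((y - c) / r) => {}a {}b {}y.
move=> /(is_gap_affine _ _ _ _ r0) gab hy nAy.
have len u v : c + r * v - (c + r * u) = r * (v - u) by ring.
have upE : c + r * b + alpha * (c + r * b - (c + r * a)) = c + r * (b + alpha * (b - a)) by ring.
have downE : c + r * a - alpha * (c + r * b - (c + r * a)) = c + r * (a - alpha * (b - a)) by ring.
have lt u v : (c + r * u < c + r * v) = (u < v) by rewrite ltrD2l ltr_pM2l.
have [||u [v [guv /andP[uy yv] dc]]] := tA a b y gab; first by move=> Ay; apply: nAy; exists y.
  by move: hy; rewrite upE downE !lt.
exists (c + r * u), (c + r * v); split; first exact/is_gap_affine.
  by rewrite !lt uy.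
by rewrite !len ltr_pM2l.
Qed.

End AffineGaps.

(** * Middle Cantor sets *)

Section MiddleCantor.
Variables (R : realType) (lam : R).
Hypothesis lam0 : 0 < lam.
Hypothesis lam_lt_half : lam + lam < 1.
Implicit Types (x y z a b s beta : R) (k : nat).

Ltac lam_lra := move: lam0 lam_lt_half; lra.

(** The two similarities of ratio [lam] that generate the Cantor set are
x |-> s + lam * x for these two values of s. *)
Definition offset s := s = 0 \/ s = 1 - lam.

Definition unscale s x : R := (x - s) / lam.

Fixpoint cantor_stage k : set R :=
  if k is k'.+1 then [set x | exists2 s, offset s & cantor_stage k' (unscale s x)]
  else `[0, 1].

Definition middle_cantor : set R := \bigcap_k cantor_stage k.
Local Notation C := middle_cantor.

Let lam_neq0 : lam != 0. Proof. exact: lt0r_neq0. Qed.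

Lemma offsetK s x : unscale s (s + lam * x) = x.
Proof. by rewrite /unscale addrAC subrr add0r mulrC mulKf. Qed.

Lemma offsetE s x : x = s + lam * (unscale s x).
Proof. by rewrite /unscale mulrC divfK// addrC subrK. Qed.

Lemma unscale_itv s x : (0 <= unscale s x <= 1) = (s <= x <= s + lam).
Proof. by rewrite /unscale ler_pdivlMr// ler_pdivrMr// mul0r mul1r subr_ge0 lerBlDl. Qed.

Lemma cantor_stage_itv k x : cantor_stage k x -> 0 <= x <= 1.
Proof.
elim: k x => [x|k IH x [s os /IH]]; first by rewrite /= in_itv.
rewrite {3 4}(offsetE s x); move: (unscale s x) => y /andP[y0 y1].
have h0 : 0 <= lam * y by apply: mulr_ge0 => //; exact: ltW.
have h1 : lam * y <= lam by rewrite ger_pMr.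
case: os => ->; lam_lra.
Qed.

Lemma middle_cantor_itv x : C x -> 0 <= x <= 1.
Proof. by move=> /(_ 0%N I) /cantor_stage_itv. Qed.

Lemma middle_cantor_sim s y : offset s -> C y -> C (s + lam * y).
Proof.
move=> os Cy [_|k _].
  have /andP[y0 y1] := middle_cantor_itv Cy; rewrite /= in_itv /=.
  have h0 : 0 <= lam * y by apply: mulr_ge0 => //; exact: ltW.
  have h1 : lam * y <= lam by rewrite ger_pMr.
  by case: os => ->; lam_lra.
by exists s => //; rewrite offsetK; exact: Cy.
Qed.

(** The stages could a priori pick the two offsets alternately; the position of
[x] relative to [lam] forces one choice for all of them. *)
Lemma middle_cantor_inv x : C x -> exists2 s, offset s & C (unscale s x).
Proof.
move=> Cx; have [xl|lx] := leP x lam.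
  exists 0; [by left|move=> k _]; have [s [->//|-> /cantor_stage_itv]] := Cx k.+1 I.
  by rewrite unscale_itv; lam_lra.
exists (1 - lam); [by right|move=> k _]; have [s [->|->//]] := Cx k.+1 I.
by move=> /cantor_stage_itv; rewrite unscale_itv; lam_lra.
Qed.

(** The restriction on [y] matters: for [y] outside [0, 1], the point s + lam * y
can fall in the other half of the Cantor set. *)
Lemma middle_cantor_sub s y : offset s -> 0 <= y <= 1 -> C (s + lam * y) -> C y.
Proof.
move=> os /andP[y0 y1] /middle_cantor_inv[s' os' C'].
suff es : s' = s by move: C'; rewrite es offsetK.
have := middle_cantor_itv C'; rewrite unscale_itv.
have h0 : 0 <= lam * y by apply: mulr_ge0 => //; exact: ltW.
have h1 : lam * y <= lam by rewrite ger_pMr.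
by case: os os' => -> [->|->] //; lam_lra.
Qed.

Lemma middle_cantor0 : C 0.
Proof.
move=> k _; elim: k => [|k IH]; first by rewrite /= in_itv /= lexx ler01.
by exists 0; [left|rewrite /unscale subr0 mul0r].
Qed.

Lemma middle_cantor1 : C 1.
Proof.
move=> k _; elim: k => [|k IH]; first by rewrite /= in_itv /= lexx ler01.
by exists (1 - lam); [right|rewrite /unscale opprB addrC subrK divff].
Qed.

Lemma closed_cantor_stage k : closed (cantor_stage k).
Proof.
elim: k => [|k IH /=]; first exact: itv_closed.
rewrite (_ : mkset _ = unscale 0 @^-1` cantor_stage k `|`
   unscale (1 - lam) @^-1` cantor_stage k); last first.
  apply/seteqP; split => x /=; first by case=> s [->|->]; [left|right].
  by case=> h; [exists 0; [left|]|exists (1 - lam); [right|]].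
apply: closedU; apply: preimage_closed => // x _; apply: cvgM; try exact: cvg_cst;
  by apply: cvgB; [exact: cvg_id|exact: cvg_cst].
Qed.

Lemma compact_middle_cantor : compact C.
Proof.
apply: (subclosed_compact _ (@segment_compact R 0 1)).
  by apply: closed_bigI => k _; exact: closed_cantor_stage.
by move=> x /middle_cantor_itv; rewrite /= in_itv.
Qed.

Lemma is_gap_sim s a b : offset s -> is_gap C a b -> is_gap C (s + lam * a) (s + lam * b).
Proof.
move=> os [ab Ca Cb gab].
have /andP[a0 _] := middle_cantor_itv Ca; have /andP[_ b1] := middle_cantor_itv Cb.
split; [by rewrite ltrD2l ltr_pM2l|exact: middle_cantor_sim|exact: middle_cantor_sim|].
move=> x; rewrite (offsetE s x) !ltrD2l !ltr_pM2l//; move: (unscale s x) => y /andP[ay yb].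
by move=> /(middle_cantor_sub os) Cy; apply: (gab y); [rewrite ay|apply: Cy; lam_lra].
Qed.

Lemma gap_cases a b : is_gap C a b -> (a = lam /\ b = 1 - lam) \/
  exists s a' b', [/\ offset s, is_gap C a' b', a = s + lam * a' & b = s + lam * b'].
Proof.
move=> [ab Ca Cb gab].
have [s os Ca'] := middle_cantor_inv Ca; have [t ot Cb'] := middle_cantor_inv Cb.
move: ab Ca Cb gab; rewrite (offsetE s a) (offsetE t b).
move: (unscale s a) Ca' (unscale t b) Cb' => a' Ca' b' Cb' ab Ca Cb gab.
have /andP[a0 a1] := middle_cantor_itv Ca'; have /andP[b0 b1] := middle_cantor_itv Cb'.
have [est|nst] := eqVneq s t.
  subst t; right; exists s, a', b'; split=> //; split=> //.
    by move: ab; rewrite ltrD2l ltr_pM2l.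
  move=> x /andP[ax xb] /(middle_cantor_sim os); apply: gab.
  by rewrite !ltrD2l !ltr_pM2l// ax.
have ha0 : 0 <= lam * a' by apply: mulr_ge0 => //; exact: ltW.
have ha1 : lam * a' <= lam by rewrite ger_pMr.
have hb0 : 0 <= lam * b' by apply: mulr_ge0 => //; exact: ltW.
have hb1 : lam * b' <= lam by rewrite ger_pMr.
case: os ot => es [] et; subst s t; rewrite ?eqxx// in nst; last by exfalso; lam_lra.
have C1 : C (0 + lam * 1) by apply: middle_cantor_sim; [left|exact: middle_cantor1].
have C2 : C (1 - lam + lam * 0) by apply: middle_cantor_sim; [right|exact: middle_cantor0].
left; split; apply/eqP; rewrite eq_le; apply/andP; split; try lam_lra;
  rewrite leNgt; apply/negP => h; by [apply: (gab _ _ C1); lam_lra|apply: (gab _ _ C2); lam_lra].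
Qed.

(** Every gap is obtained from the central one by finitely many similarities,
since undoing a similarity multiplies the length by 1 / lam, and the lengths are
at most 1. *)
Lemma gap_ind (Q : R -> R -> Prop) : Q lam (1 - lam) ->
  (forall s a b, offset s -> is_gap C a b -> Q a b -> Q (s + lam * a) (s + lam * b)) ->
  forall a b, is_gap C a b -> Q a b.
Proof.
move=> Q0 QS; have step k : forall a b, is_gap C a b -> lam ^+ k < b - a -> Q a b.
  elim: k => [|k IH] a b gab.
    have [_ Ca Cb _] := gab; rewrite expr0.
    by have := middle_cantor_itv Ca; have := middle_cantor_itv Cb; lam_lra.
  have [[-> ->]//|[s [a' [b' [os gab' -> ->]]]] h] := gap_cases gab.
  apply: QS => //; apply: IH => //; move: h.
  by rewrite opprD addrACA subrr add0r -mulrBr exprS ltr_pM2l.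
move=> a b gab; have [ab _ _ _] := gab.
have /cvg_expr cv : `|lam| < 1 by rewrite gtr0_norm//; lam_lra.
have /cvgrPdist_lt/(_ (b - a)) := cv; rewrite subr_gt0 => /(_ ab)[k _ /(_ k (leqnn _))] /=.
rewrite sub0r normrN ger0_norm ?exprn_ge0 ?(ltW lam0)// => h.
exact: step h.
Qed.

Lemma gap_length a b : is_gap C a b -> b - a <= 1 - lam - lam.
Proof.
move: a b; apply: gap_ind => // s a b _ _ h.
rewrite opprD addrACA subrr add0r -mulrBr.
have : lam * (b - a) <= lam * (1 - lam - lam) by rewrite ler_pM2l.
have : lam * (1 - lam - lam) <= 1 - lam - lam by rewrite ger_pMl; lam_lra.
lam_lra.
Qed.

(** By self-similarity it suffices to treat the central gap.  The assumption on
[beta] says that the points to be considered lie in one of the two halves; every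
gap inside a half is the image of a gap, hence shorter than the central one. *)
Lemma thick_middle_cantor beta : 0 < beta -> beta * (1 - lam - lam) <= lam ->
  thick C beta.
Proof.
move=> b0 hb a b y + nCy; move: a b y nCy.
suff H a b : is_gap C a b -> forall y, ~ C y ->
    b < y < b + beta * (b - a) \/ a - beta * (b - a) < y < a ->
    exists c d, [/\ is_gap C c d, c < y < d & d - c < b - a].
  by move=> a b y nCy gab; exact: H.
move: a b; apply: gap_ind.
  move=> y nCy hy; have [s os /andP[z0 z1]] :
      exists2 s, offset s & 0 < unscale s y < 1.
    case: hy => hy; [exists (1 - lam); [by right|]|exists 0; [by left|]];
      rewrite /unscale ltr_pdivlMr// ltr_pdivrMr//; lam_lra.
  move: z0 z1 nCy hy; rewrite (offsetE s y) offsetK; move: (unscale s y) => z z0 z1 nCy _.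
  have [||c [d [gcd /andP[cz zd] _ _]]] := gap_around (compact_closed (@norm_hausdorff _ _)
    compact_middle_cantor) middle_cantor0 middle_cantor1 (y := z); first by rewrite z0.
    by move=> Cz; apply: nCy; exact: middle_cantor_sim.
  exists (s + lam * c), (s + lam * d); split; first exact: is_gap_sim.
    by rewrite !ltrD2l !ltr_pM2l// cz.
  rewrite opprD addrACA subrr add0r -mulrBr.
  have : lam * (d - c) <= lam * (1 - lam - lam) by rewrite ler_pM2l// gap_length.
  have : lam * (1 - lam - lam) < 1 - lam - lam by rewrite gtr_pMl; lam_lra.
  lam_lra.
move=> s a b os gab IH y; rewrite (offsetE s y); move: (unscale s y) => {}y nCy.
have len u v : s + lam * v - (s + lam * u) = lam * (v - u) by ring.
have lt u v : (s + lam * u < s + lam * v) = (u < v) by rewrite ltrD2l ltr_pM2l.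
have -> : s + lam * b + beta * (s + lam * b - (s + lam * a)) = s + lam * (b + beta * (b - a)) by ring.
have -> : s + lam * a - beta * (s + lam * b - (s + lam * a)) = s + lam * (a - beta * (b - a)) by ring.
rewrite !lt => hy.
have [|c [d [gcd /andP[cy yd] dc]]] := IH y _ hy.
  by move=> Cy; apply: nCy; exact: middle_cantor_sim.
exists (s + lam * c), (s + lam * d); split; first exact: is_gap_sim.
  by rewrite !lt cy.
by rewrite !len ltr_pM2l.
Qed.

Lemma cantor_stage_cover k : exists cs : seq R, size cs = (2 ^ k)%N /\
  forall x, cantor_stage k x -> exists2 c, c \in cs & c <= x <= c + lam ^+ k.
Proof.
elim: k => [|k [cs [sz IH]]].
  by exists [:: 0]; split=> // x; rewrite /= in_itv => ?; exists 0; rewrite ?mem_head ?add0r ?expr0.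
exists (map (fun c => 0 + lam * c) cs ++ map (fun c => 1 - lam + lam * c) cs).
split; first by rewrite size_cat !size_map sz expnS mul2n addnn.
move=> x [s os /IH [c ccs]].
rewrite {3 4}(offsetE s x); move: (unscale s x) => y hy.
exists (s + lam * c).
  rewrite mem_cat; apply/orP; case: os => ->; [left|right]; exact: (map_f (fun c => _ + lam * c)).
by rewrite exprS -addrA -mulrDr !lerD2l !ler_pM2l.
Qed.

End MiddleCantor.

(** * Sets of positive Newhouse thickness *)

Section NewhouseThick.
Variable R : realType.
Implicit Types (K P H U C : set R) (a b e x y z eps l : R).
Local Notation len := (@lebesgue_measure R).

Lemma component_is_gap P a b x : is_gap P a b -> a < x < b ->
  connected_component (~` P) x = `]a, b[%classic.
Proof.
move=> [ab Pa Pb gab] /andP[ax xb]; apply/seteqP; split.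
  have itv : is_interval (connected_component (~` P) x).
    by apply: (proj1 (connected_intervalP _)); exact: component_connected.
  have sub := @connected_component_sub _ (~` P) x.
  have cx : connected_component (~` P) x x.
    by apply: connected_component_refl; apply: gab; rewrite ax.
  move=> y cy; rewrite /= in_itv /= !ltNge; apply/andP; split; apply/negP => h.
    by apply: (sub a) => //; apply: (itv y x); rewrite // h ltW.
  by apply: (sub b) => //; apply: (itv x y); rewrite // h ltW.
apply: connected_component_max; first by rewrite /= in_itv /= ax.
  by move=> y; rewrite /= in_itv /=; exact: gab.
by apply: (proj2 (connected_intervalP _)); exact: interval_is_interval.
Qed.

Lemma gap_itv P a b : is_gap P a b -> gap P `]a, b[.
Proof.
move=> gab; have [ab _ _ h] := gab.
have m : a < (a + b) / 2 < b by lra.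
by exists ((a + b) / 2); [exact: h|rewrite (component_is_gap gab m)].
Qed.

Lemma len_bounded_itv (s t : bool) a b : a <= b ->
  len [set` Interval (BSide s a) (BSide t b)] = (b - a)%:E.
Proof.
rewrite le_eqVlt => /predU1P[->|ab]; rewrite lebesgue_measure_itv /= lte_fin.
  by rewrite ltxx subrr.
by rewrite ab EFinB.
Qed.

(** A component of finite length is bounded, so the set has points on both
sides of it. *)
Lemma short_component_gap P y l : closed P -> ~ P y ->
  (len (connected_component (~` P) y) < l%:E)%E ->
  exists c d, [/\ is_gap P c d, c < y < d & d - c < l].
Proof.
move=> clP nPy short; set Y := connected_component _ _ in short.
have Yitv : is_interval Y by apply: (proj1 (connected_intervalP _)); exact: component_connected.
have sub_half (H : interval R) : [set` H] y -> [set` H] `<=` ~` P -> (len [set` H] < +oo)%E.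
  move=> Hy HP; apply: (@le_lt_trans _ _ (len Y)); last by apply: (lt_trans short); exact: ltry.
  apply: le_measure; rewrite ?inE; [exact: measurable_itv|exact: measurable_realfun.is_interval_measurable|].
  apply: connected_component_max => //.
  by apply: (proj2 (connected_intervalP _)); exact: interval_is_interval.
have [d Pd yd] : exists2 d, P d & y < d.
  apply: contrapT => h; have := @sub_half `[y, +oo[%R.
  rewrite lebesgue_measure_itv /= in_itv /= lexx ?ltry ?ltNyr => /(_ erefl) fin.
  suff: (+oo < +oo :> \bar R)%E by rewrite ltxx.
  apply: fin.
  move=> x /=; rewrite in_itv /= andbT le_eqVlt => /predU1P[<-//|yx] Px.
  by apply: h; exists x.
have [c Pc cy] : exists2 c, P c & c < y.
  apply: contrapT => h; have := @sub_half `]-oo, y]%R.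
  rewrite lebesgue_measure_itv /= in_itv /= lexx ?ltry ?ltNyr => /(_ erefl) fin.
  suff: (+oo < +oo :> \bar R)%E by rewrite ltxx.
  apply: fin.
  move=> x /=; rewrite in_itv /= le_eqVlt => /predU1P[->//|yx] Px.
  by apply: h; exists x.
have [|a [b [gab aybb _ _]]] := gap_around clP Pc Pd (y := y) _ nPy; first by rewrite cy.
exists a, b; split=> //; have [ab _ _ _] := gab.
by move: short; rewrite /Y (component_is_gap gab aybb) len_bounded_itv ?(ltW ab).
Qed.

(** An explicit formula for the bridge at [e]: the points of [H] that can be
joined to [e] without meeting a gap at least as long as [U]. *)
Definition reach P U H e : set R :=
  [set x | H x /\ forall U', gap P U' -> (len U <= len U')%E ->
     forall z, e <= z <= x \/ x <= z <= e -> ~ U' z].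

(** Any competitor D containing the bridge also contains [e], and being an
interval it contains the segment from [e] to each of its points. *)
Lemma bridge_reach P U H e : is_interval H -> H e -> ~ (interior H) e -> P e ->
  bridge P U H e (reach P U H e).
Proof.
move=> iH He nHe Pe.
have gapP U' x : gap P U' -> U' x -> ~ P x by case=> z _ -> /connected_component_sub.
have re : reach P U H e e.
  split=> // U' gU' _ z ze; have -> : z = e by apply/eqP; rewrite eq_le andbC; case: ze.
  by move=> /(gapP _ _ gU').
split; last first.
  move=> D [iD DH fD hD] rD; apply/seteqP; split=> // x Dx; split; first exact: DH.
  move=> U' gU' lU' z zx U'z; have De := rD _ re.
  have : (D `&` U') z by split=> //; case: zx => zx; [exact: (iD e x)|exact: (iD x e)].
  by rewrite hD.
split.
- move=> x y [Hx hx] [Hy hy] z xzy; split; first exact: (iH x y).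
  move=> U' gU' lU' w wz; have [we|ew|->] := ltgtP w e.
  + by apply: (hx U') => //; right; case: wz => wz; lra.
  + by apply: (hy U') => //; left; case: wz => wz; lra.
  + by move=> /(gapP _ _ gU').
- by move=> x [].
- split; first exact: subset_closure.
  by move=> h; apply: nHe; apply: interiorS h => x [].
- move=> U' gU' lU'; rewrite -subset0 => x [[_ h] U'x]; apply: (h U' gU' lU' x) => //.
  by rewrite lexx !andbT; apply/orP; exact: le_total.
Qed.

Lemma bridge_long P a b e H eps : is_gap P a b -> 0 < eps ->
  (eps%:E <= cantor_thickness P)%E ->
  (bridge P `]a, b[ `[b, +oo[ b H \/ bridge P `]a, b[ `]-oo, a] a H) ->
  ((eps * (b - a))%:E <= len H)%E.
Proof.
move=> gab eps0 ht hH; have [ab _ _ _] := gab.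
have : (eps%:E <= len H / len `]a, b[%classic)%E.
  by apply: le_trans ht _; apply: ereal_inf_lbound; exists a, b, H; split=> //; exact: gap_itv.
rewrite len_bounded_itv ?(ltW ab)// inver gt_eqF ?subr_gt0// lee_pdivlMr ?subr_gt0//.
Qed.

Lemma len_le_itv C a b : a <= b -> is_interval C -> C `<=` `[a, b] -> (len C <= (b - a)%:E)%E.
Proof.
move=> ab iC Cab; have : (len C <= len `[a, b]%classic)%E.
  by apply: le_measure; rewrite ?inE; [exact: measurable_realfun.is_interval_measurable|exact: measurable_itv|].
by rewrite len_bounded_itv.
Qed.

(** If [y] were not in the bridge, then the bridge would be too short for the
bound on the thickness.  So [y] is in the bridge, which meets only components
shorter than the gap from [a] to [b]. *)
Lemma cantor_thickness_thick P eps : closed P -> 0 < eps ->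
  (eps%:E <= cantor_thickness P)%E -> thick P eps.
Proof.
move=> clP eps0 ht a b y gab nPy hy; have [ab Pa Pb _] := gab.
(* It remains to place [y] in one of the two bridges. *)
have finish H e : reach P `]a, b[ H e y ->
    exists c d, [/\ is_gap P c d, c < y < d & d - c < b - a].
  case=> _ hr; apply: short_component_gap => //.
  rewrite -(len_bounded_itv false true) ?(ltW ab)// ltNge; apply/negP => h.
  apply: (hr _ _ h y); [by exists y|by rewrite lexx !andbT; apply/orP; exact: le_total|].
  exact: connected_component_refl.
case: hy => /andP[h1 h2]; [apply: (finish `[b, +oo[%classic b)|apply: (finish `]-oo, a]%classic a)].
  have br : bridge P `]a, b[ `[b, +oo[ b (reach P `]a, b[ `[b, +oo[ b).
    apply: bridge_reach => //; first exact: interval_is_interval.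
      by rewrite /= in_itv /= lexx.
    by rewrite interior_itv /= in_itv /= ltxx.
  have long := bridge_long b gab eps0 ht (or_introl br).
  apply: contrapT => nry; have [[ir rH _ _] _] := br.
  have : (len (reach P `]a, b[ `[b, +oo[ b) <= (y - b)%:E)%E.
    apply: len_le_itv => //; first exact: ltW.
    move=> x rx; have := rH _ rx; rewrite /= !in_itv /= andbT => bx; rewrite bx /= leNgt.
    apply/negP => yx; apply: nry; apply: (ir b x) => //; last by rewrite !ltW.
    split; first by rewrite /= in_itv /= lexx.
    move=> U' gU' lU' z hz U'z; case: rx => _ /(_ U' gU' lU' z); apply=> //.
    by left; lra.
  by move=> /(le_trans long); rewrite lee_fin; lra.
have br : bridge P `]a, b[ `]-oo, a] a (reach P `]a, b[ `]-oo, a] a).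
  apply: bridge_reach => //; first exact: interval_is_interval.
    by rewrite /= in_itv /= lexx.
  by rewrite interior_itv /= in_itv /= ltxx.
have long := bridge_long a gab eps0 ht (or_intror br).
apply: contrapT => nry; have [[ir rH _ _] _] := br.
have : (len (reach P `]a, b[ `]-oo, a] a) <= (a - y)%:E)%E.
  apply: len_le_itv => //; first exact: ltW.
  move=> x rx; have := rH _ rx; rewrite /= !in_itv /= => bx; rewrite bx andbT leNgt.
  apply/negP => yx; apply: nry; apply: (ir x a) => //; last by rewrite !ltW.
  split; first by rewrite /= in_itv /= lexx.
  move=> U' gU' lU' z hz U'z; case: rx => _ /(_ U' gU' lU' z); apply=> //.
  by right; lra.
by move=> /(le_trans long); rewrite lee_fin; lra.
Qed.

Lemma perfect_part_sub K : perfect_part K `<=` K.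
Proof. by move=> x []. Qed.

Lemma closed_perfect_part K : closed K -> closed (perfect_part K).
Proof.
move=> clK x clx; split.
  by apply: clK; apply: closure_subset clx; exact: perfect_part_sub.
move=> V oV Vx; have [y [[Ky hy] Vy]] := clx V (open_nbhs_nbhs (conj oV Vx)).
exact: hy.
Qed.

(** Every point removed here has a neighbourhood with rational endpoints that
meets [K] in a countable set, and there are countably many such intervals. *)
Lemma countable_non_condensation K : countable (K `\` perfect_part K).
Proof.
pose small := [set q : rat * rat | countable (`]ratr q.1, ratr q.2[ `&` K)].
apply: (@sub_countable _ _ _ (\bigcup_(q in small) (`]ratr q.1, ratr q.2[ `&` K))); last first.
  by apply: bigcup_countable => //; exact: countableP.
apply: subset_card_le => x [Kx nPx].
have [V oV [Vx cV]] : exists2 V : set R, open V & V x /\ countable (V `&` K).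
  apply: contrapT => h; apply: nPx; split=> // V oV Vx cV; apply: h.
  by exists V.
have /nbhs_ballP[r /= r0 xrV] := open_nbhs_nbhs (conj oV Vx).
have [|p] := @rat_in_itvoo R (x - r) x; first by lra.
rewrite in_itv /= => /andP[p1 p2].
have [|q] := @rat_in_itvoo R x (x + r); first by lra.
rewrite in_itv /= => /andP[q1 q2].
exists (p, q); last by split=> //=; rewrite in_itv /= p2.
apply: sub_countable cV; apply: subset_card_le => y [/= + Ky].
rewrite in_itv /= => /andP[py yq]; split=> //; apply: xrV.
by rewrite /ball /= ltr_distlC; lra.
Qed.

(** If there were only one condensation point, then [K] would be countable and
would have none. *)
Lemma perfect_part_two_points K : perfect_part K !=set0 ->
  exists a b, [/\ perfect_part K a, perfect_part K b & a < b].
Proof.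
move=> [p Pp]; apply: contrapT => h; have [_ /(_ setT openT I)] := Pp; apply.
rewrite setTI.
apply: (@sub_countable _ _ _ (\bigcup_(i : bool) (if i then [set p] else K `\` perfect_part K))); last first.
  apply: bigcup_countable; first exact: countableP.
  by case=> _; [exact: countable1|exact: countable_non_condensation].
apply: subset_card_le => x Kx.
have [Px|nPx] := pselect (perfect_part K x); [exists true => //=|by exists false].
apply/eqP; rewrite eq_le !leNgt; apply/andP; split; apply/negP => xp; apply: h.
  by exists p, x.
by exists x, p.
Qed.

Lemma newhouse_thick K : compact K -> (0 < newhouse_thickness K)%E ->
  (exists a b, a < b /\ `[a, b] `<=` K) \/
  exists P eps, [/\ compact P, P `<=` K, 0 < eps, thick P eps &
                    exists a b, [/\ P a, P b & a < b]].
Proof.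
move=> cK; rewrite /newhouse_thickness; case: asboolP => [_|P0]; first by rewrite ltxx.
case: asboolP => [[a [b [ab abP]]] _|_ t0].
  by left; exists a, b; split=> // x /abP /perfect_part_sub.
have clP : closed (perfect_part K).
  by apply: closed_perfect_part; apply: compact_closed => //; exact: norm_hausdorff.
have [eps eps0 ht] : exists2 eps, 0 < eps & (eps%:E <= cantor_thickness (perfect_part K))%E.
  case: cantor_thickness t0 => [r||//]; first by rewrite lte_fin => r0; exists r.
  by exists 1; rewrite ?leey.
right; exists (perfect_part K), eps; split=> //.
- by apply: subclosed_compact cK _ => //; exact: perfect_part_sub.
- exact: perfect_part_sub.
- exact: cantor_thickness_thick.
- by apply: perfect_part_two_points; exact/set0P/eqP.
Qed.

End NewhouseThick.

(** * Null sets with finite uniform covers *)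

Section FineCovers.
Variable R : realType.
Implicit Types (S : set R) (e l c r x : R).

(** Jordan content zero, witnessed by intervals of one common length [l] that
start at the points of [cs].  This finite form of nullness is what passes most
directly to covers of slabs by boxes. *)
Definition finely_covered S := forall e, 0 < e -> exists (cs : seq R) l,
  [/\ 0 <= l, l *+ size cs <= e &
      forall x, S x -> exists2 c, c \in cs & c <= x <= c + l].

Lemma finely_covered0 : finely_covered set0.
Proof. by move=> e e0; exists [::], 0; split=> //; exact: ltW. Qed.

Lemma finely_covered_affine S c r : 0 < r -> finely_covered S ->
  finely_covered ((fun x => c + r * x) @` S).
Proof.
move=> r0 cS e e0; have [|cs [l [l0 le h]]] := cS (e / r); first exact: divr_gt0.
exists (map (fun x => c + r * x) cs), (r * l); split.
- by rewrite mulr_ge0// ltW.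
- by rewrite size_map -mulrnAr mulrC -ler_pdivlMr.
- move=> _ [x /h[d dcs dx] <-]; exists (c + r * d); first exact: map_f.
  by rewrite -addrA -mulrDr !lerD2l !ler_pM2l.
Qed.

Lemma finely_covered_middle_cantor (lam : R) : 0 < lam -> lam + lam < 1 ->
  finely_covered (middle_cantor lam).
Proof.
move=> lam0 lam_lt_half e e0.
have /cvg_expr cv : `|lam + lam| < 1 by rewrite gtr0_norm//; lra.
have /cvgrPdist_lt/(_ e e0)[k _ /(_ k (leqnn _))] /= := cv.
rewrite sub0r normrN ger0_norm ?exprn_ge0 ?addr_ge0 ?(ltW lam0)// => ke.
have [cs [sz h]] := cantor_stage_cover lam0 k.
exists cs, (lam ^+ k); split; first by rewrite exprn_ge0 ?ltW.
  by rewrite sz -mulr_natr natrX -exprMn mulr_natr mulr2n ltW.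
by move=> x /(_ k I); exact: h.
Qed.

Lemma lebesgue_finely_covered S : measurable S -> finely_covered S ->
  lebesgue_measure S = 0%E.
Proof.
move=> mS cS; apply/eqP; rewrite eq_le measure_ge0 andbT.
apply/lee_addgt0Pr => e /cS[cs [l [l0 le h]]]; rewrite add0e.
apply: (@le_trans _ _ (l *+ size cs)%:E); last by rewrite lee_fin.
move: S mS {cS} h; elim: cs {le} => [|c cs IH] S mS h.
  suff -> : S = set0 by rewrite measure0 mulr0n.
  by apply/seteqP; split=> // x /h[].
pose I : set R := `[c, c + l]%classic.
have mI : measurable I by exact: measurable_itv.
have cover : (lebesgue_measure (S `\` I) <= (l *+ size cs)%:E)%E.
  apply: IH; first exact: measurableD.
  move=> x [/h[d + dx] nx]; rewrite inE => /predU1P[dc|dcs]; last by exists d.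
  by exfalso; apply: nx; rewrite /I /= in_itv /= -dc.
have -> : lebesgue_measure S = (lebesgue_measure (S `\` I) +
    lebesgue_measure (S `&` I))%E by exact: measureDI.
rewrite /= mulrS addrC EFinD; apply: leeD => //.
apply: (@le_trans _ _ (lebesgue_measure I)).
  by apply: le_measure; rewrite ?inE//; exact: measurableI.
by rewrite /I (len_bounded_itv true false) ?lerDl// addrAC subrr add0r.
Qed.

(** A countable union of null sets contains no interval. *)
Lemma dense_avoid (S : nat -> set R) : (forall k, closed (S k)) ->
  (forall k, finely_covered (S k)) ->
  forall a b : R, a < b -> exists2 x, a < x < b & forall k, ~ S k x.
Proof.
move=> clS cS a b ab; apply: contrapT => h.
have neg : lebesgue_measure.-negligible (\bigcup_k S k).
  apply: negligible_bigcup => k; apply/negligibleP; first exact: measurable_realfun.closed_measurable.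
  by apply: lebesgue_finely_covered => //; exact: measurable_realfun.closed_measurable.
have : lebesgue_measure (`]a, b[%classic : set R) = 0%E.
  apply: measure_negligible; first exact: measurable_itv.
  apply: negligibleS neg => x; rewrite /= in_itv /= => abx.
  apply: contrapT => nx; apply: h; exists x => // k Skx; apply: nx; by exists k.
rewrite (len_bounded_itv false true) ?(ltW ab)// => -[] /eqP.
by rewrite subr_eq0 => /eqP ba; rewrite ba ltxx in ab.
Qed.

End FineCovers.

(** Turns a double sequence of boxes into a single one, as countable covers
require. *)
Lemma nneseries_pairs (R : realType) (f : nat * nat -> \bar R) :
  (forall p, (0 <= f p)%E) -> exists h : nat -> nat * nat,
  (forall p, exists n, h n = p) /\
  (\sum_(0 <= n <oo) f (h n) = \sum_(0 <= k <oo) \sum_(0 <= j <oo) f (k, j))%E.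
Proof.
move=> f0; have /card_esym/ppcard_eqP[h] := card_nat2.
exists h; split; first by move=> p; exists (h^-1%FUN p); rewrite invK ?inE.
rewrite nneseries_esumT// -(@reindex_esum _ _ _ setT setT h f) //.
rewrite (_ : setT = [set: nat] `*`` (fun=> [set: nat])); last by apply/seteqP; split.
rewrite (_ : f = fun p => f (p.1, p.2)); last by apply/funext => -[].
rewrite -(@esum_esum _ _ _ _ _ (fun k j => f (k, j)))// nneseries_esumT.
  by apply: eq_esum => k _; rewrite nneseries_esumT.
by move=> k; apply: nneseries_ge0.
Qed.

Section Slabs.
Variables (R : realType) (d : nat).
Implicit Types (S : set R) (M : nat).

Definition slab S M : set 'cV[R]_d.+1 :=
  [set x : 'cV[R]_d.+1 | S (x 0 0) /\ forall i, `|x i 0| <= M%:R].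

Lemma lebesgue_outer_ge0 (A : set 'cV[R]_d.+1) : (0 <= lebesgue_outer A)%E.
Proof.
apply/ereal_infP => _ [a [b [ab _ ->]]]; apply: nneseries_ge0 => n _ _.
by rewrite lee_fin; apply: prodr_ge0 => i _; rewrite subr_ge0.
Qed.

(** The k-th slab is covered by finitely many boxes of total volume at most
e / 2 ^ (k + 1), one above each interval of a fine cover of [S k]. *)
Lemma lebesgue_outer_slabs (A : set 'cV[R]_d.+1) (S : nat -> set R) (M : nat -> nat) :
  (forall k, finely_covered (S k)) -> A `<=` \bigcup_k slab (S k) (M k) ->
  lebesgue_outer A = 0%E.
Proof.
move=> cS AS; apply/eqP; rewrite eq_le lebesgue_outer_ge0 andbT.
apply/lee_addgt0Pr => e e0; rewrite add0e.
pose w k : R := ((M k)%:R + (M k)%:R) ^+ d.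
have w0 k : 0 <= w k by rewrite exprn_ge0// addr_ge0.
(* [w k] is the volume of the section of the slab over a point, and [cl k] lists
   the left ends and the common length of the intervals of the cover. *)
have /choice[cl hcl] : forall k, exists p : seq R * R,
    [/\ 0 <= p.2, (p.2 *+ size p.1) * w k <= e / (2 ^ k.+1)%:R &
        forall x, S k x -> exists2 c, c \in p.1 & c <= x <= c + p.2].
  move=> k; have pos : 0 < e / (2 ^ k.+1)%:R by rewrite divr_gt0// ltr0n expn_gt0.
  (* The summand 1 avoids dividing by [w k], which may be zero. *)
  have [|cs [l [l0 le h]]] := cS k (e / (2 ^ k.+1)%:R / (1 + w k)).
    by rewrite divr_gt0// ltr_pwDl.
  exists (cs, l); split=> //=.
  rewrite ler_pdivlMr ?ltr_pwDl// in le; apply: le_trans le.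
  by rewrite ler_wpM2l ?mulrn_wge0// lerDr.
(* Beyond the end of the list, the boxes are reduced to the origin; their volume
   is zero because the dimension is positive. *)
pose a (p : nat * nat) : 'cV[R]_d.+1 := if (p.2 < size (cl p.1).1)%N then
  \col_i (if i == 0 then nth 0 (cl p.1).1 p.2 else - (M p.1)%:R) else 0.
pose b (p : nat * nat) : 'cV[R]_d.+1 := if (p.2 < size (cl p.1).1)%N then
  \col_i (if i == 0 then nth 0 (cl p.1).1 p.2 + (cl p.1).2 else (M p.1)%:R) else 0.
have ab p i : a p i 0 <= b p i 0.
  rewrite /a /b; case: ifP => _; rewrite !mxE//; case: ifP => _.
    by rewrite lerDl; case: (hcl p.1).
  by rewrite -subr_ge0 opprK addr_ge0.
have vol p : box_volume (a p) (b p) =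
    if (p.2 < size (cl p.1).1)%N then (cl p.1).2 * w p.1 else 0.
  rewrite /box_volume big_ord_recl /a /b; case: ifP => _; last by rewrite !mxE subrr mul0r.
  rewrite !mxE eqxx addrAC subrr add0r; congr (_ * _).
  under eq_bigr => i _ do rewrite !mxE /= opprK.
  by rewrite prodr_const card_ord.
have vol0 p : (0 <= (box_volume (a p) (b p))%:E)%E.
  by rewrite lee_fin; apply: prodr_ge0 => i _; rewrite subr_ge0.
have [h [hs hsum]] := nneseries_pairs vol0.
apply: (@le_trans _ _ (\sum_(0 <= n <oo) (box_volume (a (h n)) (b (h n)))%:E)%E).
  apply: ereal_inf_lbound; exists (a \o h), (b \o h); split=> //; first by move=> k i; exact: ab.
  move=> x /AS[k _ [Sx xM]]; have [l0 _ /(_ _ Sx)[c ccs cx]] := hcl k.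
  have [n hn] := hs (k, index c (cl k).1); exists n => // i.
  rewrite /= hn /a /b /= index_mem ccs !mxE nth_index//.
  by case: eqP => [->//|_]; rewrite -ler_norml.
rewrite hsum; apply: le_trans (epsilon_trick0 xpredT (ltW e0)).
apply: lee_nneseries => [k _ _|k _]; first exact: nneseries_ge0.
have [l0 le _] := hcl k.
rewrite (nneseries_split 0 (size (cl k).1))// add0n eseries0 ?adde0; last first.
  by move=> j sj _; rewrite vol /= ltnNge sj.
rewrite big_mkord (eq_bigr (fun=> ((cl k).2 * w k)%:E)); last first.
  by move=> j _; rewrite vol /= ltn_ord.
by rewrite sumEFin sumr_const card_ord lee_fin -mulrnAl.
Qed.

End Slabs.

(** * The null set that meets every thick set *)

Section TheNullSet.
Variable R : realType.
Implicit Types (n M : nat) (q : rat) (t x : R).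

(** The solution lam of (n + 1) * (1 - 2 * lam) = lam, which gives the middle
Cantor set thickness exactly n + 1. *)
Definition ratio n : R := n.+1%:R / (n.+1%:R + n.+1%:R + 1).

Lemma ratio_gt0 n : 0 < ratio n.
Proof. by rewrite divr_gt0// ltr_wpDl// addr_ge0. Qed.

Lemma ratioE n : ratio n * (n.+1%:R + n.+1%:R + 1) = n.+1%:R.
Proof. by rewrite divfK// gt_eqF// ltr_wpDl// addr_ge0. Qed.

Lemma ratio_lt n : ratio n + ratio n < 1.
Proof. by rewrite /ratio -mulrDl ltr_pdivrMr ?mul1r ?ltrDl// ltr_wpDl// addr_ge0. Qed.

Lemma thick_ratio_cantor n : thick (middle_cantor (ratio n)) n.+1%:R.
Proof.
apply: thick_middle_cantor; [exact: ratio_gt0|exact: ratio_lt|by []|].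
have := ratioE n; rewrite !mulrDr mulr1 mulrN mulrC; lra.
Qed.

Definition dilated_cantor n t : set R :=
  (fun x => t + n.+1%:R * x) @` middle_cantor (ratio n).

Lemma compact_dilated_cantor n t : compact (dilated_cantor n t).
Proof.
apply: continuous_compact; last exact: compact_middle_cantor (ratio_gt0 n) (ratio_lt n).
apply: continuous_subspaceT => x; apply: cvgD; first exact: cvg_cst.
by apply: cvgM; [exact: cvg_cst|exact: cvg_id].
Qed.

Lemma closed_dilated_cantor n t : closed (dilated_cantor n t).
Proof. by apply: compact_closed; [exact: norm_hausdorff|exact: compact_dilated_cantor]. Qed.

Lemma finely_covered_dilated_cantor n t : finely_covered (dilated_cantor n t).
Proof.
apply: finely_covered_affine => //.
by apply: finely_covered_middle_cantor; [exact: ratio_gt0|exact: ratio_lt].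
Qed.

Lemma dilated_cantor_left n t : dilated_cantor n t t.
Proof. by exists 0; [exact: middle_cantor0|rewrite mulr0 addr0]. Qed.

Lemma dilated_cantor_right n t : dilated_cantor n t (t + n.+1%:R).
Proof. by exists 1; [by apply: middle_cantor1; exact: ratio_gt0|rewrite mulr1]. Qed.

(** The left end of the dilated Cantor set is placed between two points of t + K;
the natural number n + 1 serves both as a thickness, to beat 1 / eps, and as a
diameter, to have the right end fall beyond the second point. *)
Lemma dilated_cantor_hit (K : set R) t : compact K -> (0 < newhouse_thickness K)%E ->
  exists2 x, K x & exists n q, dilated_cantor n (ratr q) (t + x).
Proof.
move=> cK /(newhouse_thick cK) [[a [b [ab abK]]]|[P [eps [cP PK eps0 tP [a [b [Pa Pb ab]]]]]]].
  have [|q] := @rat_in_itvoo R (t + a) (t + b); first by rewrite ltrD2l.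
  rewrite in_itv /= => /andP[aq qb]; exists (ratr q - t).
    by apply: abK; rewrite /= in_itv /=; lra.
  by exists 0%N, q; rewrite addrC subrK; exact: dilated_cantor_left.
have [|q] := @rat_in_itvoo R (t + a) (t + b); first by rewrite ltrD2l.
rewrite in_itv /= => /andP[aq qb].
pose n := Num.truncn (eps^-1 + (b - a)).
have hn : eps^-1 + (b - a) < n.+1%:R by exact: truncnS_gt.
have ei : 0 < eps^-1 by rewrite invr_gt0.
have cD := @compact_dilated_cantor n (ratr q - t).
have tD : thick (dilated_cantor n (ratr q - t)) n.+1%:R.
  by apply: thick_affine => //; exact: thick_ratio_cantor.
have [||||x [Px [z Cz zx]]] := gap_lemma cP cD tP tD eps0 (ltr0Sn R n) _ Pa
  (@dilated_cantor_left n _) Pb (@dilated_cantor_right n _).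
- by rewrite mulrC -ler_pdivrMr// mul1r; lra.
- lra.
- lra.
- lra.
exists x; first exact: PK.
exists n, q, z => //; rewrite -zx; ring.
Qed.

(** A single enumeration of all the dilated Cantor sets, each together with all
bounds [M] on the other coordinates: the measure in R^d of a cylinder is
computed on bounded pieces. *)
Definition null_pieces (k : nat) : set R * nat :=
  if unpickle k is Some (n, q, M) then (dilated_cantor n (ratr q), M) else (set0, 0%N).

Lemma null_piecesE n q M : exists k, null_pieces k = (dilated_cantor n (ratr q), M).
Proof. by exists (pickle (n, q, M)); rewrite /null_pieces pickleK. Qed.

Lemma null_pieces_closed k : closed (null_pieces k).1.
Proof.
rewrite /null_pieces; case: unpickle => [[[n q] M]|] /=; last exact: closed0.
exact: closed_dilated_cantor.
Qed.

Lemma null_pieces_covered k : finely_covered (null_pieces k).1.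
Proof.
rewrite /null_pieces; case: unpickle => [[[n q] M]|] /=; last exact: finely_covered0.
exact: finely_covered_dilated_cantor.
Qed.

End TheNullSet.

(** * The cylinder over the complement of the null set *)

Section Cylinder.
Variables (R : realType) (d : nat).

Definition avoiding : set 'cV[R]_d.+1 :=
  \bigcap_k [set x : 'cV[R]_d.+1 | ~ (null_pieces R k).1 (x 0 0)].

Lemma Gdelta_avoiding : Gdelta avoiding.
Proof.
exists (fun k => [set x : 'cV[R]_d.+1 | ~ (null_pieces R k).1 (x 0 0)]) => // k.
apply: closed_openC; apply: (@preimage_closed _ _ (fun x : 'cV[R]_d.+1 => x 0 0)).
  by move=> x _; exact: coord_continuous.
exact: null_pieces_closed.
Qed.

(** It is enough to perturb the first coordinate. *)
Lemma dense_avoiding : dense avoiding.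
Proof.
move=> O [x Ox] oO; have /nbhs_ballP[r /= r0 xrO] := open_nbhs_nbhs (conj oO Ox).
have [|y xy hy] := dense_avoid (@null_pieces_closed R) (@null_pieces_covered R)
  (a := x 0 0) (b := x 0 0 + r); first by rewrite ltrDl.
exists (\col_i (if i == 0 then y else x i 0)); split; last by move=> k _; rewrite /= mxE eqxx.
apply: xrO; split=> // i j; rewrite mxE (ord1 j); case: eqP => [->|_]; last exact: ballxx.
by rewrite /ball /= ltr_distlC; lra.
Qed.

Lemma lebesgue_outer_avoiding : lebesgue_outer (~` avoiding) = 0%E.
Proof.
apply: (@lebesgue_outer_slabs _ _ _ (fun k => (null_pieces R k).1) (fun k => (null_pieces R k).2)).
  exact: null_pieces_covered.
move=> x /existsNP[k /not_implyP[_ /contrapT]].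
rewrite {1}/null_pieces; case: unpickle => [[[n q] m]|//] /= Dx.
pose M := Num.truncn (\sum_i `|x i 0|).
have [l lE] := null_piecesE R n q M.+1; exists l => //.
rewrite lE; split=> // i; apply: le_trans (ltW (truncnS_gt _)).
by rewrite (bigD1 i)//= lerDl sumr_ge0.
Qed.

End Cylinder.

Lemma compact_linear_projection (R : realType) (d : nat) (E : set 'cV[R]_d.+1)
    (T : 'M[R]_d.+1) : compact E -> compact (@proj_x1 R d @` [set T *m x | x in E]).
Proof.
move=> cE; rewrite image_comp; apply: (continuous_compact _ cE); apply: continuous_subspaceT.
rewrite (_ : _ \o _ = fun x : 'cV[R]_d.+1 => \sum_j T ord0 j * x j ord0); last first.
  by apply/funext => x; rewrite /= /proj_x1 mxE.
move=> x; apply: (cvg_big _ (Fa := fun j => T ord0 j * x j ord0)); first exact: add_continuous.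
  exact: nbhs_filter.
move=> j _; apply: (@continuousM R 'cV[R]_d.+1 (fun=> T ord0 j) (fun y => y j ord0)).
  exact: cst_continuous.
exact: coord_continuous.
Qed.

Theorem theorem1p7 (R : realType) (d : nat) (E : set 'cV[R]_d.+1) :
  cantor_set E -> newhouse_projectively_thick E -> ~ generically_universal E.
Proof.
move=> [_ _ _ cE] thickE /(_ _ (@Gdelta_avoiding R d) (@dense_avoiding R d)
  (@lebesgue_outer_avoiding R d)) [F [t [T [uT ->]]] sub].
have cK : compact (@proj_x1 R d @` [set T *m x | x in E]) by exact: compact_linear_projection.
have [_ [_ [x Ex <-] <-] [n [q hit]]] := dilated_cantor_hit (t 0 0) cK (thickE T uT).
have [k kE] := null_piecesE R n q 0.
have : avoiding (t + T *m x) by apply: sub; exists x.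
by move=> /(_ k I); rewrite /= kE mxE.
Qed.
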